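(* Let $\sigma\in\{213,312,231,132\}$. For every $n\ge2$ and every $k$ with $0\le k\le n-2$, the number of words $w\in\mathcal{P}_{n-1}^2(\sigma)$ with $\mathrm{des}(w)=k$ equals $$\frac{2}{n+1}\binom{n+1}{k+2}\binom{n-2}{k}.$$
   Context: $\mathfrak{S}_n$ is the set of permutations of $[n]=\{1,\dots,n\}$; $\mathrm{FIX}(\pi)=\{i:\pi(i)=i\}$. A $2$-arrangement of $[n]$ is a pair $(\pi,\phi)$ with $\pi\in\mathfrak{S}_n$ and $\phi:\mathrm{FIX}(\pi)\to\{-1,-2\}$ arbitrary. Its permutation form is the word obtained from $\pi(1)\cdots\pi(n)$ by replacing $\pi(i)$ with $-1$ for each $i\in\mathrm{FIX}(\pi)$ with $\phi(i)=-1$, and then replacing every occurrence of the $j$-th smallest positive letter by $j$ for all $j$. $\mathcal{P}_n^2$ is the set of permutation forms of $2$-arrangements of $[n]$. For an integer word $w=w_1\cdots w_n$, $\mathrm{des}(w)=|\{i\in[n-1]:w_i>w_{i+1}\}|$; $\mathrm{red}(w)$ replaces every occurrence of the $j$-th smallest letter by $j$; $w$ avoids $\sigma\in\mathfrak{S}_3$ if there are no $i_1<i_2<i_3$ with $\mathrm{red}(w_{i_1}w_{i_2}w_{i_3})=\sigma$. $\mathcal{P}_n^2(\sigma)$ is the set of words in $\mathcal{P}_n^2$ avoiding $\sigma$. *)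

(* Defs.v *)
From mathcomp Require Import all_boot all_order all_algebra perm.
Set Implicit Arguments.
Unset Strict Implicit.
Unset Printing Implicit Defensive.
Import Order.TTheory GRing.Theory Num.Theory.
Local Open Scope ring_scope.

(* Permutations of [n] are modelled by 'S_n (permutations of 'I_n = {0..n-1});
   the position i : 'I_n stands for i+1 and the value pi i for (pi i)+1.   *)

Definition FIX n (pi : 'S_n) : {set 'I_n} := [set i | pi i == i].

(* A 2-arrangement (pi, phi) is encoded by pi together with the set
   S = phi^{-1}(-1) \subset FIX(pi); phi is -2 on FIX(pi) \ S. *)

Definition std_pos (w : seq int) : seq int :=
  [seq (if 0 < x then (Posz (count (fun y : int => (0 < y) && (y <= x)) (undup w)))
        else x) | x : int <- w].

Definition pform n (pi : 'S_n) (S : {set 'I_n}) : seq int :=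
  std_pos [seq (if i \in S then -1 else ((pi i).+1)%:Z) | i <- enum 'I_n].

Definition P2 n : seq (seq int) :=
  undup (flatten [seq [seq pform pi T | T : {set 'I_n} <- enum {set 'I_n} & T \subset FIX pi]
                 | pi : 'S_n <- enum 'S_n]).

Definition red (w : seq int) : seq nat :=
  [seq count (fun y : int => y <= x) (undup w) | x : int <- w].

Definition avoids (sigma : seq nat) (w : seq int) : bool :=
  ~~ [exists i1 : 'I_(size w), exists i2 : 'I_(size w), exists i3 : 'I_(size w),
        [&& (i1 < i2)%N, (i2 < i3)%N &
            red [:: nth 0 w i1; nth 0 w i2; nth 0 w i3] == sigma]].

Definition P2av n (sigma : seq nat) : seq (seq int) := [seq w <- P2 n | avoids sigma w].

Definition des (w : seq int) : nat :=
  count (fun p : int * int => p.2 < p.1) (zip w (behead w)).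

(* Main.v *)
(* The permutation forms of length m are exactly the words with a letters -1
   whose other letters form a permutation of 1 .. m - a.  Let p be the descent
   generating function of the sigma-avoiding permutations by length and w the
   one of the words.  An avoiding word is cut at the first occurrence of one
   letter: the smallest one for 213 and 312, the largest one for 231 and 132.
   Avoidance forces the two parts to be comparable letter by letter, so that
   their lengths determine their letters.  This gives p = 1 + x p (1 + t (p - 1))
   and a linear equation for w over p, whose solution is w = p^2 for all four
   patterns.  The equation for p also says
     p^(r+1) = p^r + x ((1 - t) p^(r+1) + t p^(r+2)),
   a recursion that determines the coefficients of every power of p. *)
Require Import Defs.
From mathcomp Require Import all_boot all_order all_algebra perm.
From mathcomp Require Import zify ring.
Set Implicit Arguments.
Unset Strict Implicit.
Unset Printing Implicit Defensive.
Import Order.TTheory GRing.Theory Num.Theory.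
Local Open Scope ring_scope.

(** * The Narayana recurrence and the powers of its solution *)

Definition conv (R : pzSemiRingType) (f g : nat -> R) (m : nat) : R :=
  \sum_(i < m.+1) f i * g (m - i)%N.

(** Truncated polynomials stand in for power series; [N] is left free so that several convolutions
    can share one truncation. *)
Lemma conv_coef (R : nzRingType) (f g : nat -> R) N m : (m < N)%N ->
  conv f g m = ((\poly_(i < N) f i) * (\poly_(i < N) g i))`_m.
Proof.
move=> hm; rewrite coefM; apply: eq_bigr => i _; rewrite !coef_poly.
by rewrite (leq_trans (ltn_ord i) hm) (leq_ltn_trans (leq_subr _ _) hm).
Qed.

Lemma eq_conv (R : pzSemiRingType) (f f' g g' : nat -> R) m :
  (forall i, (i <= m)%N -> f i = f' i) -> (forall i, (i <= m)%N -> g i = g' i) ->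
  conv f g m = conv f' g' m.
Proof.
move=> hf hg; apply: eq_bigr => i _.
by rewrite hf ?hg // ?leq_subr // -ltnS.
Qed.

(** Inherited from associativity of polynomial multiplication, since truncation at [m.+1] keeps the
    coefficients up to [m]. *)
Lemma convA (R : nzRingType) (f g h : nat -> R) m :
  conv f (conv g h) m = conv (conv f g) h m.
Proof.
pose P (f : nat -> R) := \poly_(i < m.+1) f i.
have P_conv f' g' i : (i < m.+1)%N -> (P (conv f' g'))`_i = (P f' * P g')`_i.
  by move=> hi; rewrite coef_poly hi (conv_coef _ _ hi).
rewrite !(@conv_coef _ _ _ m.+1) //.
transitivity ((P f * (P g * P h))`_m).
  by rewrite !coefM; apply: eq_bigr => i _; rewrite P_conv // ltnS leq_subr.
rewrite mulrA ![in LHS]coefM [RHS]coefM; apply: eq_bigr => i _.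
by rewrite P_conv.
Qed.

Lemma conv_recl (R : pzSemiRingType) (f g : nat -> R) m :
  conv f g m.+1 = f 0%N * g m.+1 + conv (fun i => f i.+1) g m.
Proof. by rewrite /conv big_ord_recl subn0; congr (_ + _). Qed.

(** As $p_0=1$, the left factor has generating function $1+t(p-1)$ with $t$ = ['X]; the condition
    reads $p=1+xp(1+t(p-1))$. *)
Definition is_narayana (p : nat -> {poly rat}) :=
  p 0%N = 1 /\ forall m, p m.+1 = conv (fun i => 'X ^+ (0 < i)%N * p i) p m.

Section Narayana.

Variable p : nat -> {poly rat}.
Let q i := 'X ^+ (0 < i)%N * p i.
Let v := conv p p.

Hypothesis p0 : p 0%N = 1.
Hypothesis pS : forall m, p m.+1 = conv q p m.

Lemma narayana_conv_tail f m :
  conv q f m = f m + 'X * (conv p f m - f m).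
Proof.
rewrite /conv !big_ord_recl /q /= !subn0 p0 expr0 !mul1r.
rewrite addrAC subrr add0r; congr (_ + _).
by rewrite mulr_sumr; apply: eq_bigr => i _; rewrite mulrA.
Qed.

Lemma narayana_step m : p m.+1 = p m + 'X * (v m - p m).
Proof. by rewrite pS narayana_conv_tail. Qed.

Lemma narayana_sum m : p m.+1 = 1 + 'X * \sum_(b < m.+1) (v b - p b).
Proof.
elim: m => [|m IH]; rewrite narayana_step; last first.
  by rewrite {1}IH [in RHS]big_ord_recr /= [in RHS]mulrDr addrA.
by rewrite big_ord1 p0.
Qed.

(** In generating functions, $p=1+xqp$ multiplied by $p$ gives $p^2=p+xqp^2$. *)
Lemma narayana_sqrS m : v m.+1 = p m.+1 + conv q v m.
Proof.
rewrite /v conv_recl p0 mul1r convA; congr (_ + _).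
by apply: eq_conv => // i _; rewrite pS.
Qed.

(** Each way of cutting words yields its own recursion [F]. Since [F] looks only at earlier values,
    it suffices that $p^2$ satisfies it too. *)
Lemma sqr_uniq (w : nat -> {poly rat}) (F : (nat -> {poly rat}) -> nat -> {poly rat}) :
  w 0%N = v 0%N -> (forall m, w m.+1 = F w m) -> (forall m, v m.+1 = F v m) ->
  (forall f g m, (forall i, (i <= m)%N -> f i = g i) -> F f m = F g m) ->
  forall m, w m = v m.
Proof.
move=> w0 wS vS Fext; elim/ltn_ind => -[|m] IH //.
by rewrite wS vS; apply: Fext => i hi; apply: IH.
Qed.

Lemma sqr0 : v 0%N = 1.
Proof. by rewrite /v /conv big_ord1 p0 mulr1. Qed.

(** Serves 213 and 312, where [p m.+1] accounts for the words without a letter -1. *)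
Lemma eq_sqr_min (w : nat -> {poly rat}) : w 0%N = 1 ->
  (forall m, w m.+1 = p m.+1 + conv q w m) -> forall m, w m = v m.
Proof.
move=> w0 wS; apply: (@sqr_uniq w (fun w m => p m.+1 + conv q w m)) => //.
- by rewrite w0 sqr0.
- exact: narayana_sqrS.
- by move=> f g m fg; congr (_ + _); apply: eq_conv.
Qed.

(** For $w=p^2$ the first and last terms add up to [p m.+1] by [narayana_sum], which leaves
    [narayana_sqrS]. *)
Lemma eq_sqr_231 (w : nat -> {poly rat}) : w 0%N = 1 ->
  (forall m, w m.+1 = 1 + conv q w m + 'X * \sum_(b < m.+1) (w b - p b)) ->
  forall m, w m = v m.
Proof.
move=> w0 wS.
apply: (@sqr_uniq w (fun w m => 1 + conv q w m + 'X * \sum_(b < m.+1) (w b - p b))) => //.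
- by rewrite w0 sqr0.
- by move=> m; rewrite narayana_sqrS narayana_sum addrAC.
- move=> f g m fg; congr (_ + _ + _ * _); first exact: eq_conv.
  by apply: eq_bigr => i _; rewrite fg // -ltnS.
Qed.

Lemma eq_sqr_132 (w : nat -> {poly rat}) : w 0%N = 1 ->
  (forall m, w m.+1 = 1 + w m + 'X * \sum_(b < m) w b
                      + 'X * conv p (fun i => w i - 1) m) ->
  forall m, w m = v m.
Proof.
move=> w0 wS.
apply: (@sqr_uniq w (fun w m => 1 + w m + 'X * \sum_(b < m) w b
                      + 'X * conv p (fun i => w i - 1) m)) => //.
- by rewrite w0 sqr0.
- move=> m; rewrite narayana_sqrS narayana_conv_tail narayana_sum.
  (* Convolving [p] with the constant 1 gives its partial sums, the same ones that [narayana_sum]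
     brings in on the other side. *)
  have -> : conv p (fun i => v i - 1) m = conv p v m - \sum_(i < m.+1) p i.
    by rewrite /conv -sumrB; apply: eq_bigr => i _; rewrite mulrBr mulr1.
  rewrite sumrB big_ord_recr /=; ring.
- move=> f g m fg; congr (_ + _ + _ * _ + _ * _).
  + by rewrite fg.
  + by apply: eq_bigr => i _; rewrite fg // ltnW.
  + by apply: eq_conv => // i hi; rewrite fg.
Qed.

(* Lagrange inversion for p = 1 + u, u = x (1 + u) (1 + t u): the coefficient of
   u^(M+1) in this polynomial is that of x^(M+1) in p^r. *)
Let lagrange M r : {poly {poly rat}} :=
  (1 + 'X) ^+ (M + r) * (1 + 'X%:P * 'X) ^+ M * (1 - 'X%:P * 'X ^+ 2).

Lemma coef_exp1X (R : comNzRingType) (c : R) n i :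
  ((1 + c%:P * 'X) ^+ n)`_i = 'C(n, i)%:R * c ^+ i.
Proof.
rewrite exprDn coef_sum.
have E (j : 'I_n.+1) :
    (1 ^+ (n - j) * (c%:P * 'X) ^+ j *+ 'C(n, j))`_i = (i == j)%:R * ('C(n, i)%:R * c ^+ i).
  rewrite expr1n mul1r exprMn -rmorphXn /= coefMn coefCM coefXn.
  case: eqP => [->|_]; rewrite ?(mulr1, mul1r, mulr0, mul0rn, mul0r) //.
  by rewrite mulr_natl.
rewrite (eq_bigr _ (fun j _ => E j)) -mulr_suml.
have [hi|hi] := ltnP i n.+1; last by rewrite bin_small // mul0r mulr0.
rewrite (bigD1 (Ordinal hi)) //= eqxx big1 ?addr0 ?mul1r // => j.
by rewrite -val_eqE /= eq_sym => /negPf ->.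
Qed.

Lemma coef_exp1X1 (R : comNzRingType) n i : ((1 + 'X) ^+ n : {poly R})`_i = 'C(n, i)%:R.
Proof. by rewrite -['X]mul1r (coef_exp1X 1) expr1n mulr1. Qed.

Lemma coef_binom2 a b n k :
  (((1 + 'X) ^+ a * (1 + 'X%:P * 'X) ^+ b : {poly {poly rat}})`_n)`_k =
  if (k <= n)%N then ('C(b, k) * 'C(a, n - k))%:R else 0.
Proof.
rewrite mulrC coefM coef_sum.
have E (j : 'I_n.+1) : (((1 + 'X%:P * 'X) ^+ b)`_j *
    ((1 + 'X) ^+ a : {poly {poly rat}})`_(n - j))`_k
    = (k == j)%:R * ('C(b, k) * 'C(a, n - k))%:R.
  rewrite coef_exp1X coef_exp1X1.
  rewrite mulrAC -[in LHS]natrM mulr_natl coefMn coefXn.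
  by case: eqP => [->|_]; rewrite ?(mul1r, mul0r, mul0rn).
rewrite (eq_bigr _ (fun j _ => E j)) -mulr_suml -ltnS.
have [hk|hk] := ltnP k n.+1; last first.
  rewrite big1 ?mul0r // => j _; case: eqP => // kj.
  by move: (ltn_ord j); rewrite -kj ltnNge hk.
rewrite (bigD1 (Ordinal hk)) //= eqxx big1 ?addr0 ?mul1r // => j.
by rewrite -val_eqE /= eq_sym => /negPf ->.
Qed.

Lemma coef_lagrange M r k : ((lagrange M r)`_M.+1)`_k =
  ((if (k <= M.+1)%N then ('C(M, k) * 'C(M + r, M.+1 - k))%:R else 0)
  - (if (0 < k <= M)%N then ('C(M, k.-1) * 'C(M + r, M - k))%:R else 0)).
Proof.
rewrite /lagrange mulrBr mulr1 coefB coefB coef_binom2; congr (_ - _).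
(* The term $-tx^2$ shifts the index by two in $x$ and by one in $t$. *)
rewrite mulrCA coefCM coefXM; case: k => //= k.
rewrite coefMXn; case: M => [|M]; first by rewrite coef0.
by rewrite subn2 coef_binom2 ltnS !subSS.
Qed.

(** The two binomial products agree by the symmetry of binomial coefficients, just as $p^0=1$ has no
    coefficient above degree 0. *)
Lemma lagrange0 M : (lagrange M 0)`_M.+1 = 0.
Proof.
apply/polyP => k; rewrite coef_lagrange coef0 addn0.
case: k => [|k]; first by rewrite subn0 (@bin_small M M.+1) // muln0 subrr.
rewrite ltnS subSS /=.
have [hk|hk] := ltnP k M; last by rewrite (@bin_small M k.+1) // if_same subrr.
by rewrite (ltnW hk) bin_sub 1?ltnW // bin_sub // mulnC subrr.
Qed.

(** The recursion for the powers of $p$ holds already between these polynomials, because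
    $(1-t)+t(1+x)=1+tx$. *)
Lemma lagrangeS M r : (lagrange M.+1 r.+1)`_M.+2 =
  (lagrange M.+1 r)`_M.+2 + (1 - 'X) * (lagrange M r.+1)`_M.+1
  + 'X * (lagrange M r.+2)`_M.+1.
Proof.
rewrite -!coefCM -addrA -coefD.
have -> : (1 - 'X)%:P * lagrange M r.+1 + 'X%:P * lagrange M r.+2
   = (1 + 'X) ^+ (M.+1 + r) * (1 + 'X%:P * 'X) ^+ M.+1 *
     (1 - 'X%:P * 'X ^+ 2) :> {poly {poly rat}}.
  rewrite /lagrange !addnS !addSn polyCB !exprS; ring.
have -> : lagrange M.+1 r.+1 = lagrange M.+1 r +
  (1 + 'X) ^+ (M.+1 + r) * (1 + 'X%:P * 'X) ^+ M.+1 * (1 - 'X%:P * 'X ^+ 2) * 'X.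
  by rewrite /lagrange addnS exprS; ring.
by rewrite coefD coefMX.
Qed.

Lemma coef_lagrange2 M k : (k <= M)%N -> ((lagrange M 2)`_M.+1)`_k =
  (2%:R / M.+3%:R) * 'C(M.+3, k.+2)%:R * 'C(M, k)%:R.
Proof.
move=> hk; rewrite coef_lagrange (leqW hk) hk andbT addn2.
have -> : (M.+1 - k = M.+2 - k.+1)%N by rewrite subSS.
have -> : (M - k = M.+2 - k.+2)%N by rewrite !subSS.
rewrite !bin_sub ?ltnS // 1?leqW //.
have n0 i : i.+1%:R != 0 :> rat by rewrite pnatr_eq0.
have eq_div (x y z : rat) : z != 0 -> z * x = y -> x = y / z.
  by move=> z0 <-; rewrite mulrAC divff ?mul1r.
have -> : 'C(M.+3, k.+2)%:R = M.+3%:R * 'C(M.+2, k.+1)%:R / k.+2%:R :> rat.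
  by apply: eq_div => //; rewrite -!natrM -mul_bin_diag.
have E2 : 'C(M.+2, k.+2)%:R = (M.+1 - k)%:R * 'C(M.+2, k.+1)%:R / k.+2%:R :> rat.
  by apply: eq_div => //; rewrite -!natrM mul_bin_left subSS.
case: k hk E2 => [|k] hk E2 /=.
  by rewrite subr0 natrM; field; rewrite -natrD pnatr_eq0.
(* The truncated subtraction is absorbed into a binomial coefficient, so that [field] meets only
   sums. *)
have E3 : (M.+1 - k.+1)%:R * 'C(M, k)%:R = k.+1%:R * 'C(M, k.+1)%:R :> rat.
  by rewrite -!natrM subSS mul_bin_left.
have -> : ('C(M, k) * 'C(M.+2, k.+3))%:R =
   (M.+1 - k.+1)%:R * 'C(M, k)%:R  / k.+3%:R * 'C(M.+2, k.+2)%:R :> rat.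
  by rewrite natrM E2; ring.
rewrite E3 natrM.
by field; rewrite -!natrD !pnatr_eq0.
Qed.

(* Truncating at degree N makes p a polynomial without changing the coefficients
   of its powers below N. *)
Lemma coef_narayana_exp N r m : (m.+1 < N)%N ->
  ((\poly_(i < N) p i) ^+ r)`_m.+1 = (lagrange m r)`_m.+1.
Proof.
set P := \poly_(i < N) p i => mN.
have N0 : (0 < N)%N by apply: leq_trans mN.
have P0 s : (P ^+ s)`_0 = 1.
  by rewrite -horner_coef0 hornerE horner_coef0 coef_poly N0 p0 expr1n.
have PS i : (i.+1 < N)%N -> P`_i.+1 = ((1 - 'X)%:P * P + 'X%:P * P ^+ 2)`_i.
  move=> hi; rewrite coefD !coefCM coef_poly hi narayana_step.
  rewrite /v (@conv_coef _ _ _ N) 1?ltnW // -expr2.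
  have -> : p i = P`_i by rewrite coef_poly ltnW.
  by rewrite -/P; ring.
(* One factor [P] is peeled off: its constant term gives [P ^+ s], its other coefficients are
   replaced through [PS]. *)
have rec s i : (i.+1 < N)%N -> (P ^+ s.+1)`_i.+1 =
    (P ^+ s)`_i.+1 + (1 - 'X) * (P ^+ s.+1)`_i + 'X * (P ^+ s.+2)`_i.
  move=> hi; rewrite exprS coefM big_ord_recl subn0.
  have -> : P`_(@ord0 i.+1) = 1 by rewrite -(P0 1%N) expr1.
  rewrite mul1r -addrA -!coefCM -coefD; congr (_ + _).
  have -> : (1 - 'X)%:P * (P * P ^+ s) + 'X%:P * P ^+ s.+2 =
     ((1 - 'X)%:P * P + 'X%:P * P ^+ 2) * P ^+ s by rewrite !exprS; ring.
  rewrite coefM; apply: eq_bigr => j _; rewrite lift0 subSS PS //.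
  exact: leq_ltn_trans (ltn_ord j) hi.
(* The recursion lowers the degree but raises the exponent, so the outer induction is on the degree,
   for all exponents at once. *)
elim: m r mN => [|m IHm] r mN.
  elim: r => [|r IHr]; first by rewrite lagrange0 coef1.
  rewrite rec // !P0 IHr /lagrange !add0n !expr0 !mulr1 exprS.
  have E s : ((1 + 'X) ^+ s * (1 - 'X%:P * 'X ^+ 2) : {poly {poly rat}})`_1 = s%:R.
    rewrite mulrBr mulr1 coefB mulrA coefMXn subr0.
    by rewrite coef_exp1X1 bin1.
  rewrite -exprS !E -natr1; ring.
elim: r => [|r IHr]; first by rewrite lagrange0 coef1.
by rewrite rec // IHr lagrangeS !IHm 1?ltnW.
Qed.

Lemma coef_narayana_sqr m k : (k <= m)%N -> (v m.+1)`_k =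
  (2%:R / m.+3%:R) * 'C(m.+3, k.+2)%:R * 'C(m, k)%:R.
Proof.
move=> hk; rewrite /v (@conv_coef _ _ _ m.+2) // -expr2 coef_narayana_exp //.
exact: coef_lagrange2.
Qed.

End Narayana.

(** * Splitting pattern-avoiding words *)

Lemma subseq_consP (T : eqType) (x0 a : T) s w :
  reflect (exists i, [/\ (i < size w)%N, nth x0 w i = a & subseq s (drop i.+1 w)])
          (subseq (a :: s) w).
Proof.
elim: w => [|y w IH]; first by right; case=> i [].
rewrite [subseq _ _]/=; case: eqP => [<-|ya].
  apply: (iffP idP) => [sw|[[|i] [/= hi Ei si]]]; first by exists 0%N; rewrite /= drop0.
    by rewrite drop0 in si.
  by apply: subseq_trans si _; apply: drop_subseq.
apply: (iffP IH) => [[i [hi Ei si]]|[[|i] [/= hi Ei si]]]; first by exists i.+1.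
  by case: ya.
by exists i.
Qed.

Lemma subseq_catP (T : eqType) (s s1 s2 : seq T) : subseq s (s1 ++ s2) ->
  exists u v, [/\ s = u ++ v, subseq u s1 & subseq v s2].
Proof.
case/subseqP=> m; rewrite size_cat => sz ->.
exists (mask (take (size s1) m) s1), (mask (drop (size s1) m) s2).
by rewrite !mask_subseq -mask_cat ?cat_take_drop // size_takel // sz leq_addr.
Qed.

Lemma subseq_cons2 (T : eqType) (a x : T) s w : subseq (a :: s) (x :: w) ->
  a = x /\ subseq s w \/ subseq (a :: s) w.
Proof. by rewrite [subseq _ _]/=; case: eqP => [|_] ?; [left | right]. Qed.

(** Subsequences replace index triples because they split along a concatenation. *)
Lemma avoidsP sigma (w : seq int) :
  reflect (forall a b c, subseq [:: a; b; c] w -> red [:: a; b; c] != sigma)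
          (avoids sigma w).
Proof.
apply: (iffP idP) => [av a b c|av].
  move=> /(subseq_consP 0)[i [hi <-]].
  move=> /(subseq_consP 0)[j [hj <-]] /(subseq_consP 0)[k [hk <- _]].
  rewrite drop_drop in hk *; rewrite !nth_drop !size_drop in hj hk *.
  apply: contraNN av => red_eq.
  have hj' : (i.+1 + j < size w)%N by rewrite -ltn_subRL.
  have hk' : (j.+1 + i.+1 + k < size w)%N by rewrite -ltn_subRL.
  apply/existsP; exists (Ordinal hi); apply/existsP; exists (Ordinal hj').
  apply/existsP; exists (Ordinal hk'); rewrite red_eq /= andbT; lia.
apply/existsP=> -[i /existsP[j /existsP[k /and3P[ij jk]]]].
apply/negP/av/(subseq_consP 0); exists i; split=> //.
apply/(subseq_consP 0); exists (j - i.+1)%N.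
rewrite nth_drop size_drop ltn_sub2r ?subnKC ?(leq_ltn_trans ij) //; split=> //.
rewrite drop_drop; have -> : ((j - i.+1).+1 + i.+1 = j.+1)%N by lia.
apply/(subseq_consP 0); exists (k - j.+1)%N.
rewrite nth_drop size_drop ltn_sub2r ?subnKC ?(leq_ltn_trans jk) //; split=> //.
exact: sub0seq.
Qed.

Definition pattern3 (sigma : seq nat) (q : int -> int -> int -> bool) :=
  forall a b c, (red [:: a; b; c] == sigma) = q a b c.

Ltac red3 := let a := fresh in let b := fresh in let c := fresh in
  move=> a b c; rewrite /red /= !inE;
  case: (ltgtP a b) => ?; case: (ltgtP b c) => ?; case: (ltgtP a c) => ?; subst;
  rewrite /= ?lexx; try lia;
  repeat match goal with H : is_true (_ < _) |- _ =>
    rewrite ?(ltW H) ?(lt_geF H); clear H end; by [].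

Lemma red_213 : pattern3 [:: 2; 1; 3]%N (fun a b c => b < a < c).
Proof. red3. Qed.
Lemma red_312 : pattern3 [:: 3; 1; 2]%N (fun a b c => b < c < a).
Proof. red3. Qed.
Lemma red_231 : pattern3 [:: 2; 3; 1]%N (fun a b c => c < a < b).
Proof. red3. Qed.
Lemma red_132 : pattern3 [:: 1; 3; 2]%N (fun a b c => a < c < b).
Proof. red3. Qed.

(** An occurrence with [x] in the middle is exactly a pair violating [leT]. The other hypotheses
    exclude all remaining occurrences that use [x] or meet both sides, so only those inside [L] or
    inside [R] are left. *)
Lemma avoids_split sigma q (leT : rel int) x (L R : seq int) : pattern3 sigma q ->
  (forall l r, l \in L -> r \in R -> q l x r = ~~ leT l r) ->
  (forall a b c, a \in L -> b \in L ++ x :: R -> c \in R -> leT a c -> ~~ q a b c) ->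
  (forall a b, a \in L -> b \in L -> ~~ q a b x) ->
  (forall b c, b \in R -> c \in R -> ~~ q x b c) ->
  avoids sigma (L ++ x :: R) = [&& avoids sigma L, avoids sigma R & allrel leT L R].
Proof.
move=> redq qx qLR qL qR; apply/avoidsP/and3P => [av|].
  split; last 1 first.
  - apply/allrelP => l r lL rR; rewrite -[leT _ _]negbK -qx // -redq; apply: av.
    by rewrite -[[:: _; _; _]]/([:: l] ++ [:: x; r]) cat_subseq ?sub1seq //= eqxx sub1seq.
  - apply/avoidsP=> a b c abc; apply: av; apply: subseq_trans abc _; exact: prefix_subseq.
  - apply/avoidsP=> a b c abc; apply: av; apply: subseq_trans abc _.
    by rewrite -cat_rcons; apply: suffix_subseq.
case=> /avoidsP avL /avoidsP avR /allrelP LR a b c abc; rewrite redq.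
have sub y : y \in [:: a; b; c] -> y \in L ++ x :: R by apply: mem_subseq.
(* The cases are the numbers 0, 1, 2 and 3 of letters taken from [L]. *)
have [[|a' [|b' [|c' u]]] [v [/= E uL vR]]] := subseq_catP abc.
- rewrite -E in vR; case: (subseq_cons2 vR) => [[-> sv]|sv]; last by rewrite -redq avR.
  by apply: qR; apply: (mem_subseq sv); rewrite !inE eqxx ?orbT.
- case: E uL vR => <- <-; rewrite sub1seq => aL sv.
  have cR : c \in R.
    by case: (subseq_cons2 sv) => [[_ s]|s]; apply: (mem_subseq s); rewrite !inE eqxx ?orbT.
  by rewrite qLR ?LR // sub // !inE eqxx orbT.
- case: E uL vR => <- <- <- abL /subseq_cons2 cxR.
  have [aL bL] : a \in L /\ b \in L by split; apply: (mem_subseq abL); rewrite !inE eqxx ?orbT.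
  case: cxR => [[-> _]|]; first exact: qL.
  by rewrite sub1seq => cR; rewrite qLR ?LR // sub // !inE eqxx ?orbT.
- have [Ea Eb Ec] : [/\ a = a', b = b' & c = c'] by case: E.
  have abcL : subseq [:: a; b; c] L.
    by apply: subseq_trans uL; rewrite Ea Eb Ec; apply: (prefix_subseq [:: _; _; _]).
  by rewrite -redq avL.
Qed.

Lemma des_cons x y w : des [:: x, y & w] = ((y < x)%R + des (y :: w))%N.
Proof. by []. Qed.

(** The defaults of [last] and [head] are [x] itself, so an empty side contributes no descent. *)
Lemma des_split L x R :
  des (L ++ x :: R) = (des L + ((x < last x L)%R + (head x R < x)%R) + des R)%N.
Proof.
elim: L => [|y [|z L] IH].
- case: R => [|y R]; first by rewrite /des /= ltxx.
  by rewrite cat0s des_cons /= ltxx.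
- by rewrite !cat_cons des_cons /= in IH *; rewrite IH ltxx !addnA.
- by rewrite !cat_cons des_cons [des [:: y, z & L]]des_cons -cat_cons IH /= !addnA.
Qed.

(** Sorting both parts and concatenating gives a sorted list, hence [s]; so the size of [L] fixes
    the letters on each side. *)
Lemma perm_allrel_take_drop (T : eqType) (leT : rel T) (s L R : seq T) :
  transitive leT -> antisymmetric leT -> total leT -> sorted leT s ->
  perm_eq (L ++ R) s -> allrel leT L R ->
  perm_eq L (take (size L) s) /\ perm_eq R (drop (size L) s).
Proof.
move=> tr anti tot ss LRs LR.
have E : sort leT L ++ sort leT R = s.
  apply: (sorted_eq tr anti) => //; last first.
    by apply: perm_trans LRs; apply: perm_cat; rewrite perm_sort.
  rewrite sorted_pairwise // pairwise_cat -!sorted_pairwise // !sort_sorted // !andbT.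
  by rewrite (eq_allrel_mem2 _ (mem_sort _ _) (mem_sort _ _)).
rewrite -E -(size_sort leT L) take_size_cat // drop_size_cat //.
by rewrite ![perm_eq _ (sort _ _)]perm_sym !perm_sort !perm_refl.
Qed.

Lemma allrel_take_drop (T : eqType) (leT : rel T) (s L R : seq T) i :
  transitive leT -> sorted leT s ->
  perm_eq L (take i s) -> perm_eq R (drop i s) -> allrel leT L R.
Proof.
move=> tr ss /perm_mem Ls /perm_mem Rs; rewrite (eq_allrel_mem2 _ Ls Rs).
by move: ss; rewrite sorted_pairwise // -{1}(cat_take_drop i s) pairwise_cat => /andP[].
Qed.

(** * Descent polynomials of multisets of letters *)

(** The list [s] stands for a multiset: [permutations] lists each word once even when letters
    repeat. *)
Definition des_poly sigma (s : seq int) : {poly rat} :=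
  \sum_(w <- permutations s | avoids sigma w) 'X ^+ des w.

Lemma perm_des_poly sigma s s' : perm_eq s s' -> des_poly sigma s = des_poly sigma s'.
Proof. by move=> ss'; apply/perm_big/perm_permutations. Qed.

(** Words are cut at their first [x], and [s] holds the other letters in [leT] order. A left part of
    size [i] is made of the first [i] of them; having no [x] there means that [i] is at most
    [index x s]. The descents next to [x] number [e i]. *)
Lemma des_poly_split sigma (leT : rel int) x s (e : nat -> bool) :
  transitive leT -> antisymmetric leT -> total leT -> sorted leT s ->
  (forall L R, perm_eq (L ++ R) s -> x \notin L ->
     avoids sigma (L ++ x :: R) = [&& avoids sigma L, avoids sigma R & allrel leT L R]) ->
  (forall L R, perm_eq (L ++ R) s -> x \notin L ->
     ((x < last x L)%R + (head x R < x)%R)%N = e (size L)) ->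
  des_poly sigma (x :: s) =
  \sum_(i < (index x s).+1)
     'X ^+ e i * des_poly sigma (take i s) * des_poly sigma (drop i s).
Proof.
move=> tr anti tot ss av ds.
pose Av s := [seq w <- permutations s | avoids sigma w].
have AvE w t : (w \in Av t) = perm_eq w t && avoids sigma w.
  by rewrite mem_filter mem_permutations andbC.
have lt_s i : (i < (index x s).+1)%N -> (i <= size s)%N.
  by move=> hi; apply: leq_trans (index_size x s).
pose glue (i : nat) (LR : seq int * seq int) := LR.1 ++ x :: LR.2.
pose W := [seq glue i LR | i <- iota 0 (index x s).+1,
     LR <- [seq (L, R) | L <- Av (take i s), R <- Av (drop i s)]].
have inW i L R : i \in iota 0 (index x s).+1 -> L \in Av (take i s) -> R \in Av (drop i s) ->
   [/\ size L = i, perm_eq (L ++ R) s, x \notin L & avoids sigma (L ++ x :: R)].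
  rewrite mem_iota !AvE add0n => /= hi /andP[Li aL] /andP[Ri aR].
  have LRs : perm_eq (L ++ R) s by rewrite -(cat_take_drop i s) perm_cat.
  have xL : x \notin L by rewrite (perm_mem Li) in_take_leq ?lt_s // -leqNgt.
  split=> //; first by rewrite (perm_size Li) size_takel // lt_s.
  by rewrite av // aL aR (allrel_take_drop tr ss Li Ri).
have permW : perm_eq (Av (x :: s)) W.
  apply: uniq_perm; first by rewrite filter_uniq ?permutations_uniq.
    apply: allpairs_uniq_dep; first exact: iota_uniq.
      move=> i _; apply: allpairs_uniq; rewrite ?filter_uniq ?permutations_uniq //.
      by move=> [? ?] [? ?].
    move=> [i [L R]] [i' [L' R']] /allpairsPdep[k [LR1 [hk /allpairsP[[L1 R1] [hL hR ->]] E]]].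
    move=> /allpairsPdep[k' [LR2 [hk' /allpairsP[[L1' R1'] [hL' hR' ->]] E']]].
    have [sL _ xL _] := inW _ _ _ hk hL hR; have [sL' _ xL' _] := inW _ _ _ hk' hL' hR'.
    case: E => -> -> ->; case: E' => -> -> -> /=; rewrite /glue /= => E.
    (* Neither left part contains [x], so the first [x] of the common word marks the end of both. *)
    have /eqP : size L1 = size L1'.
      have := congr1 (index x) E; rewrite !index_cat (negPf xL) (negPf xL') /= eqxx.
      by rewrite !addn0.
    move/eqP: E => + szL; rewrite eqseq_cat ?(eqP szL) //= eqseq_cons eqxx /=.
    by move=> /andP[/eqP-> /eqP->]; rewrite -sL -sL' (eqP szL).
  move=> w; rewrite AvE; apply/idP/allpairsPdep => [/andP[wxs aw]|]; last first.
    move=> [i [LR [hi /allpairsP[[L R] [/= hL hR ->]] ->]]].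
    have [_ LRs _ aLR] := inW _ _ _ hi hL hR.
    by rewrite /glue /= aLR andbT perm_catC /= perm_cons perm_catC.
  have xw : x \in w by rewrite (perm_mem wxs) mem_head.
  pose L := take (index x w) w; pose R := drop (index x w).+1 w.
  have wE : w = L ++ x :: R by rewrite -drop_index // cat_take_drop.
  have xL : x \notin L by rewrite in_take // ltnn.
  have LRs : perm_eq (L ++ R) s.
    by move: wxs; rewrite wE perm_catC /= perm_cons perm_catC.
  move: aw; rewrite wE av // => /and3P[aL aR LR].
  have [Ls Rs] := perm_allrel_take_drop tr anti tot ss LRs LR.
  exists (size L), (L, R); split=> //.
    rewrite mem_iota add0n /= ltnS; move: xL; rewrite (perm_mem Ls) in_take_leq.
      by rewrite -leqNgt.
    by rewrite -(perm_size LRs) size_cat leq_addr.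
  by apply/allpairsP; exists (L, R); rewrite !AvE Ls Rs aL aR.
have dpE t : des_poly sigma t = \sum_(w <- Av t) 'X ^+ des w by rewrite big_filter.
rewrite dpE (perm_big _ permW) big_allpairs_dep.
rewrite -[iota _ _]/(index_iota 0 _.+1) big_mkord; apply: eq_bigr => i _.
rewrite big_allpairs !dpE -mulrA big_distrlr mulr_sumr.
rewrite big_seq [RHS]big_seq; apply: eq_bigr => L hL.
rewrite mulr_sumr big_seq [RHS]big_seq; apply: eq_bigr => R hR.
have [|sL LRs xL _] := inW i L R _ hL hR; first by rewrite mem_iota leq0n add0n ltn_ord.
rewrite /glue des_split ds // sL !exprD /=; ring.
Qed.

Lemma des_junction_max x s (L R : seq int) : {in s, forall y, y < x} -> perm_eq (L ++ R) s ->
  ((x < last x L)%R + (head x R < x)%R)%N = (size L < size s)%N.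
Proof.
move=> sx LRs; have {}sx y : y \in L ++ R -> y < x by rewrite (perm_mem LRs); apply: sx.
rewrite -(perm_size LRs) size_cat -[ltnLHS]addn0 ltn_add2l.
have -> : (x < last x L) = false.
  case/lastP: L sx {LRs} => [|L y] sx; first by rewrite ltxx.
  by rewrite last_rcons lt_gtF // sx // mem_cat mem_rcons mem_head.
case: R sx {LRs} => [|y R] sx; first by rewrite ltxx.
by rewrite /= sx // mem_cat mem_head orbT.
Qed.

(** Letters of [L] differ from [x], so a nonempty [L] descends strictly to [x]; a further [x] at the
    head of [R] makes no descent. *)
Lemma des_junction_min x s (L R : seq int) : {in s, forall y, x <= y} -> perm_eq (L ++ R) s ->
  x \notin L -> ((x < last x L)%R + (head x R < x)%R)%N = (0 < size L)%N.
Proof.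
move=> sx LRs xL; have {}sx y : y \in L ++ R -> x <= y by rewrite (perm_mem LRs); apply: sx.
have -> : (head x R < x) = false.
  case: R sx {LRs} => [|y R] sx; first by rewrite ltxx.
  by rewrite ltNge sx // mem_cat mem_head orbT.
rewrite addn0; case/lastP: L sx {LRs} xL => [|L y] sx; first by rewrite ltxx.
rewrite mem_rcons inE negb_or last_rcons size_rcons eq_sym => /andP[yx _].
by rewrite lt_neqAle eq_sym yx sx // mem_cat mem_rcons mem_head.
Qed.

(** With the maximum as the middle letter, 231 forbids [r < l], so the letters are split in
    increasing order. As [x] does not recur, every cut size is possible. *)
Lemma des_poly_231_max x s : sorted <=%R s -> {in s, forall y, y < x} ->
  des_poly [:: 2; 3; 1]%N (x :: s) = \sum_(i < (size s).+1)
     'X ^+ (i < size s)%N * des_poly [:: 2; 3; 1]%N (take i s)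
                      * des_poly [:: 2; 3; 1]%N (drop i s).
Proof.
move=> ss sx.
have xs : x \notin s by apply/negP => /sx; rewrite ltxx.
rewrite (@des_poly_split _ <=%R x s (fun i => i < size s)%N) ?memNindex //.
- exact: le_trans.
- exact: le_anti.
- move=> L R LRs _.
  have {}sx y : y \in L ++ R -> y < x by rewrite (perm_mem LRs); apply: sx.
  apply: (avoids_split red_231) => [l r lL rR|a b c aL _ cR ac|a b aL bL|b c bR cR].
  + by rewrite sx ?andbT ?ltNge // mem_cat lL.
  + by rewrite ltNge ac.
  + by rewrite ltNge ltW // sx // mem_cat aL.
  + by rewrite andbC ltNge ltW // sx // mem_cat bR orbT.
- by move=> L R LRs _; apply: des_junction_max.
Qed.

(** Here the maximum in the middle forbids [l < r], so the letters are split in decreasing order. *)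
Lemma des_poly_132_max x s : sorted >=%R s -> {in s, forall y, y < x} ->
  des_poly [:: 1; 3; 2]%N (x :: s) = \sum_(i < (size s).+1)
     'X ^+ (i < size s)%N * des_poly [:: 1; 3; 2]%N (take i s)
                      * des_poly [:: 1; 3; 2]%N (drop i s).
Proof.
move=> ss sx.
have xs : x \notin s by apply/negP => /sx; rewrite ltxx.
rewrite (@des_poly_split _ >=%R x s (fun i => i < size s)%N) ?memNindex //.
- exact: ge_trans.
- exact: ge_anti.
- move=> L R LRs _.
  have {}sx y : y \in L ++ R -> y < x by rewrite (perm_mem LRs); apply: sx.
  apply: (avoids_split red_132) => [l r lL rR|a b c aL _ cR ac|a b aL bL|b c bR cR].
  + by rewrite sx ?andbT -?ltNge // mem_cat rR orbT.
  + by rewrite ltNge (ac : c <= a).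
  + by rewrite andbC ltNge ltW // sx // mem_cat bL.
  + by rewrite ltNge ltW // sx // mem_cat cR orbT.
- by move=> L R LRs _; apply: des_junction_max.
Qed.

(** The minimum in the middle forbids [l < r]. Further copies of [x] lie in [R], which agrees with
    the decreasing order. *)
Lemma des_poly_213_min x s : sorted >=%R s -> {in s, forall y, x <= y} ->
  des_poly [:: 2; 1; 3]%N (x :: s) = \sum_(i < (index x s).+1)
     'X ^+ (0 < i)%N * des_poly [:: 2; 1; 3]%N (take i s)
                      * des_poly [:: 2; 1; 3]%N (drop i s).
Proof.
move=> ss sx.
rewrite (@des_poly_split _ >=%R x s (fun i => 0 < i)%N) //.
- exact: ge_trans.
- exact: ge_anti.
- move=> L R LRs xL.
  have {}sx y : y \in L ++ R -> x <= y by rewrite (perm_mem LRs); apply: sx.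
  apply: (avoids_split red_213) => [l r lL rR|a b c aL _ cR ac|a b aL bL|b c bR cR].
  + rewrite lt_neqAle sx ?mem_cat ?lL // andbT -ltNge andb_idl // => _.
    by apply: contraNneq xL => ->.
  + by rewrite andbC ltNge (ac : c <= a).
  + by rewrite andbC ltNge sx // mem_cat aL.
  + by rewrite ltNge sx // mem_cat bR orbT.
- by move=> L R; apply: des_junction_min.
Qed.

(* Around its minimum x, a 312-avoiding word L x R has L <= R except for the
   further copies of x in R; moving x to the top of the order repairs this. *)
Definition le_top (x : int) : rel int := fun a b => (b == x) || ((a != x) && (a <= b)).

Lemma le_top_trans x : transitive (le_top x).
Proof. by move=> b a c; rewrite /le_top; lia. Qed.

Lemma le_top_anti x : antisymmetric (le_top x).
Proof. by move=> a b; rewrite /le_top; lia. Qed.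

Lemma le_top_total x : total (le_top x).
Proof. by move=> a b; rewrite /le_top; lia. Qed.

Lemma des_poly_312_min x s : sorted (le_top x) s -> {in s, forall y, x <= y} ->
  des_poly [:: 3; 1; 2]%N (x :: s) = \sum_(i < (index x s).+1)
     'X ^+ (0 < i)%N * des_poly [:: 3; 1; 2]%N (take i s)
                      * des_poly [:: 3; 1; 2]%N (drop i s).
Proof.
move=> ss sx.
rewrite (@des_poly_split _ (le_top x) x s (fun i => 0 < i)%N) //.
- exact: le_top_trans.
- exact: le_top_anti.
- exact: le_top_total.
- move=> L R LRs xL.
  have {}sx y : y \in L ++ R -> x <= y by rewrite (perm_mem LRs); apply: sx.
  have Lx y : y \in L -> y != x by apply: contraTneq => ->.
  have sx' y : y \in L ++ x :: R -> x <= y.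
    by rewrite mem_cat inE orbCA -mem_cat => /predU1P[->|/sx].
  apply: (avoids_split red_312) => [l r lL rR|a b c aL bLR cR|a b aL bL|b c bR cR].
  + have := Lx l lL; have := sx r; rewrite /le_top mem_cat rR orbT => /(_ isT); lia.
  + have := Lx a aL; have := sx' b bLR; rewrite /le_top; lia.
  + have := sx b; rewrite mem_cat bL => /(_ isT); lia.
  + have := sx c; rewrite mem_cat cR orbT => /(_ isT); lia.
- by move=> L R; apply: des_junction_min.
Qed.

(** * Words made of copies of one letter and a block of consecutive letters *)

(** The first letter varies because cutting a block leaves blocks that start elsewhere. *)
Definition block lo j : seq int := [seq Posz i | i <- iota lo j].

Lemma mem_block lo j y : (y \in block lo j) = (lo%:Z <= y < (lo + j)%:Z).
Proof.
apply/mapP/idP => [[i]|]; first by rewrite mem_iota => ? ->; lia.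
by case: y => // y h; exists y => //; rewrite mem_iota; lia.
Qed.

Lemma size_block lo j : size (block lo j) = j.
Proof. by rewrite size_map size_iota. Qed.

Lemma block_cat lo i j : block lo (i + j) = block lo i ++ block (lo + i) j.
Proof. by rewrite /block iotaD map_cat. Qed.

Lemma blockS lo j : block lo j.+1 = rcons (block lo j) (lo + j)%:Z.
Proof. by rewrite -addn1 block_cat cats1. Qed.

Lemma take_block lo i j : (i <= j)%N -> take i (block lo j) = block lo i.
Proof.
by move=> ij; rewrite -(subnKC ij) block_cat take_size_cat // size_block.
Qed.

Lemma drop_block lo i j : (i <= j)%N -> drop i (block lo j) = block (lo + i) (j - i).
Proof.
by move=> ij; rewrite -{1}(subnKC ij) block_cat drop_size_cat // size_block.
Qed.

Lemma sorted_block lo j : sorted <=%R (block lo j).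
Proof. by rewrite sorted_map (eq_sorted (e' := leq)) // iota_sorted. Qed.

Lemma sorted_nseq_block x a lo j : x <= lo%:Z -> sorted <=%R (nseq a x ++ block lo j).
Proof.
move=> xlo; rewrite sorted_pairwise; last exact: le_trans.
rewrite pairwise_cat -!sorted_pairwise; try exact: le_trans.
rewrite sorted_block andbT; apply/andP; split.
  by apply/allrelP => y z; rewrite mem_nseq mem_block => /andP[_ /eqP->]; lia.
by rewrite (sorted_pairwise le_trans); elim: a => //= a ->; rewrite andbT all_nseq lexx orbT.
Qed.

Definition word_poly sigma x a lo j := des_poly sigma (nseq a x ++ block lo j).

(** The only word is constant: its triples reduce to 111, which lacks the letter 2, and it has no
    descent. *)
Lemma des_poly_nseq sigma a x : 2 \in sigma -> des_poly sigma (nseq a x) = 1.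
Proof.
move=> s2; rewrite /des_poly (perm_big [:: nseq a x]); last first.
  apply: uniq_perm; rewrite ?permutations_uniq // => w.
  rewrite mem_permutations inE; apply/idP/eqP => [|-> //].
  move=> wx; have := perm_size wx; rewrite size_nseq => <-; apply/all_pred1P.
  by rewrite (perm_all _ wx) all_pred1_nseq.
have av : avoids sigma (nseq a x).
  apply/avoidsP => b c d bcd.
  have E y : y \in [:: b; c; d] -> y = x.
    by move=> /(mem_subseq bcd); rewrite mem_nseq => /andP[_ /eqP].
  have [-> -> ->] : [/\ b = x, c = x & d = x] by split; apply: E; rewrite !inE eqxx ?orbT.
  rewrite /red /= !inE !eqxx /= lexx /=.
  by apply/negP => /eqP s111; move: s2; rewrite -s111.
rewrite big_mkcond big_seq1 av; have -> : des (nseq a x) = 0%N; last by rewrite expr0.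
case: a {av} => // a; elim: a => // a IH.
by rewrite /= des_cons -[_ :: _]/(nseq a.+1 x) IH ltxx.
Qed.

Lemma perm_nseq_blockS x a lo j :
  perm_eq (nseq a x ++ block lo j.+1) ((lo + j)%:Z :: nseq a x ++ block lo j).
Proof. by rewrite blockS -rcons_cat perm_rcons. Qed.

(** The cut is at the greatest letter. If fewer than [a] copies of [x] stand on its left, that side
    is constant and contributes 1; otherwise all copies are on the left and the block is divided. *)
Lemma word_poly_231S x a lo j : x < lo%:Z ->
  word_poly [:: 2; 3; 1]%N x a lo j.+1 =
  'X * \sum_(i < a) word_poly [:: 2; 3; 1]%N x (a - i) lo j +
  \sum_(i < j.+1) 'X ^+ (i < j)%N * word_poly [:: 2; 3; 1]%N x a lo i
                    * word_poly [:: 2; 3; 1]%N x 0 (lo + i) (j - i).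
Proof.
move=> xlo; rewrite /word_poly (perm_des_poly _ (perm_nseq_blockS _ _ _ _)).
rewrite des_poly_231_max; last 2 first.
- exact/sorted_nseq_block/ltW.
- by move=> y; rewrite mem_cat mem_nseq mem_block => /orP[/andP[_ /eqP->]|]; lia.
rewrite size_cat size_nseq size_block -addnS big_split_ord /=; congr (_ + _).
  rewrite mulr_sumr; apply: eq_bigr => i _; rewrite ltn_addr // expr1.
  rewrite take_cat drop_cat size_nseq ltn_ord take_nseq 1?ltnW // drop_nseq.
  by rewrite des_poly_nseq // mulr1.
apply: eq_bigr => i _; have ij : (i <= j)%N by rewrite -ltnS.
rewrite ltn_add2l take_cat drop_cat size_nseq [(a + i < a)%N]ltnNge leq_addr /= addKn.
by rewrite take_block // drop_block.
Qed.

Lemma perm_rev_block a x lo j : perm_eq (rev (block lo j) ++ nseq a x) (nseq a x ++ block lo j).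
Proof. by rewrite perm_catC perm_cat2l perm_rev. Qed.

Lemma sorted_rev_block x a lo j : x <= lo%:Z -> sorted >=%R (rev (block lo j) ++ nseq a x).
Proof.
move=> xlo; rewrite -[nseq a x]revK rev_nseq -rev_cat rev_sorted.
exact: sorted_nseq_block.
Qed.

Lemma take_rev_block i a x lo j : (i <= j)%N ->
  perm_eq (take i (rev (block lo j) ++ nseq a x)) (block (lo + j - i) i).
Proof.
move=> ij; rewrite takel_cat ?size_rev ?size_block // take_rev size_block.
by rewrite drop_block ?leq_subr // subKn // addnBA // perm_rev.
Qed.

Lemma drop_rev_block i a x lo j : (i <= j)%N ->
  perm_eq (drop i (rev (block lo j) ++ nseq a x)) (nseq a x ++ block lo (j - i)).
Proof.
move=> ij; rewrite drop_cat size_rev size_block; case: ltngtP ij => // [ij _|-> _].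
  by rewrite drop_rev size_block take_block ?leq_subr // perm_rev_block.
by rewrite subnn drop0 cats0.
Qed.

(** The left part takes the largest letters first. The first term has an empty right part, the
    second a right part of copies of [x] only, and the last divides the block. *)
Lemma word_poly_132S x a lo j : x < lo%:Z ->
  word_poly [:: 1; 3; 2]%N x a lo j.+1 =
  word_poly [:: 1; 3; 2]%N x a lo j + 'X * \sum_(i < a) word_poly [:: 1; 3; 2]%N x i lo j +
  'X * \sum_(i < j) word_poly [:: 1; 3; 2]%N x 0 (lo + j - i) i
                    * word_poly [:: 1; 3; 2]%N x a lo (j - i).
Proof.
move=> xlo; rewrite /word_poly (perm_des_poly _ (perm_nseq_blockS _ _ _ _)).
have pr := perm_rev_block a x lo j.
rewrite (@perm_des_poly _ (_ :: nseq a x ++ _) ((lo + j)%:Z :: rev (block lo j) ++ nseq a x));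
  last by rewrite perm_cons perm_sym.
rewrite des_poly_132_max; last 2 first.
- exact/sorted_rev_block/ltW.
- by move=> y; rewrite (perm_mem pr) mem_cat mem_nseq mem_block => /orP[/andP[_ /eqP->]|]; lia.
rewrite size_cat size_nseq size_rev size_block -addnS big_split_ord /= addrC; congr (_ + _).
  rewrite big_ord_recr /= ltnn expr0 mul1r addrC; congr (_ + _).
    rewrite take_oversize ?drop_oversize ?size_cat ?size_rev ?size_block ?size_nseq //.
    by rewrite (perm_des_poly _ pr) (@des_poly_nseq _ 0 0) // mulr1.
  rewrite mulr_sumr; apply: eq_bigr => i _; rewrite ltn_add2l ltn_ord expr1.
  rewrite take_cat drop_cat size_rev size_block [(j + i < j)%N]ltnNge leq_addr /= addKn.
  rewrite take_nseq 1?ltnW // drop_nseq des_poly_nseq // mulr1.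
  by rewrite (perm_des_poly _ (perm_rev_block _ _ _ _)).
rewrite mulr_sumr; apply: eq_bigr => i _; have ij := ltnW (ltn_ord i).
rewrite ltn_addr // expr1 -mulrA.
by rewrite (perm_des_poly _ (take_rev_block _ _ _ ij))
  (perm_des_poly _ (drop_rev_block _ _ _ ij)).
Qed.

(** Holds for [a = 0] as well, where [index] returns the size; hence the cut sizes run from 0 to [j]
    in every case. *)
Lemma index_block_nseq x a lo j s : x < lo%:Z -> perm_eq s (block lo j) ->
   index x (s ++ nseq a x) = j.
Proof.
move=> xlo sj; rewrite index_cat (perm_mem sj) mem_block leNgt xlo /=.
rewrite (perm_size sj) size_block; case: a => [|a] /=; rewrite ?eqxx addn0 //.
Qed.

Lemma word_poly_213S x a lo j : x < lo%:Z ->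
  word_poly [:: 2; 1; 3]%N x a.+1 lo j =
  \sum_(i < j.+1) 'X ^+ (0 < i)%N * word_poly [:: 2; 1; 3]%N x 0 (lo + j - i) i
                    * word_poly [:: 2; 1; 3]%N x a lo (j - i).
Proof.
move=> xlo; rewrite /word_poly /=.
have pr := perm_rev_block a x lo j.
rewrite (@perm_des_poly _ (_ :: nseq a x ++ _) (x :: rev (block lo j) ++ nseq a x));
  last by rewrite perm_cons perm_sym.
rewrite des_poly_213_min; last 2 first.
- exact/sorted_rev_block/ltW.
- by move=> y; rewrite (perm_mem pr) mem_cat mem_nseq mem_block => /orP[/andP[_ /eqP->]|]; lia.
rewrite (@index_block_nseq _ _ lo j) ?perm_rev //; apply: eq_bigr => i _.
have ij : (i <= j)%N by rewrite -ltnS.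
by rewrite (perm_des_poly _ (take_rev_block _ _ _ ij))
  (perm_des_poly _ (drop_rev_block _ _ _ ij)).
Qed.

Lemma sorted_block_top x a lo j : x < lo%:Z -> sorted (le_top x) (block lo j ++ nseq a x).
Proof.
move=> xlo; rewrite sorted_pairwise; last exact: le_top_trans.
rewrite pairwise_cat; apply/and3P; split.
- by apply/allrelP => y z _; rewrite mem_nseq /le_top => /andP[_ ->].
- have := sorted_block lo j; rewrite (sorted_pairwise le_trans).
  apply: (@sub_in_pairwise _ [in block lo j]); last exact/allP.
  by move=> y z; rewrite !mem_block /le_top; lia.
- by elim: a => //= a ->; rewrite andbT all_nseq /le_top eqxx orbT.
Qed.

Lemma word_poly_312S x a lo j : x < lo%:Z ->
  word_poly [:: 3; 1; 2]%N x a.+1 lo j =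
  \sum_(i < j.+1) 'X ^+ (0 < i)%N * word_poly [:: 3; 1; 2]%N x 0 lo i
                    * word_poly [:: 3; 1; 2]%N x a (lo + i) (j - i).
Proof.
move=> xlo; rewrite /word_poly /=.
have pr : perm_eq (block lo j ++ nseq a x) (nseq a x ++ block lo j) by rewrite perm_catC.
rewrite (@perm_des_poly _ (_ :: nseq a x ++ _) (x :: block lo j ++ nseq a x));
  last by rewrite perm_cons perm_sym.
rewrite des_poly_312_min; last 2 first.
- exact: sorted_block_top.
- by move=> y; rewrite (perm_mem pr) mem_cat mem_nseq mem_block => /orP[/andP[_ /eqP->]|]; lia.
rewrite (@index_block_nseq _ _ lo j) //; apply: eq_bigr => i _.
have ij : (i <= j)%N by rewrite -ltnS.
rewrite takel_cat ?size_block // take_block //.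
rewrite (@perm_des_poly _ (drop _ _) (nseq a x ++ block (lo + i) (j - i))) //.
rewrite drop_cat size_block; case: ltngtP ij => // [ij _|-> _].
  by rewrite drop_block 1?ltnW // perm_catC.
by rewrite subnn drop0 cats0.
Qed.

(** * Summing over the number of letters -1 *)

Section TriangularSums.

Variables (V : nmodType).
Implicit Type F : nat -> nat -> V.

Lemma sum_antidiagonals F m :
  \sum_(b < m) \sum_(a < b.+1) F a (b - a)%N = \sum_(a < m) \sum_(k < m - a) F a k.
Proof.
elim: m => [|m IH]; first by rewrite !big_ord0.
rewrite big_ord_recr /= {}IH [in RHS]big_ord_recr /= subSnn big_ord1.
rewrite [X in _ + X]big_ord_recr /= subnn addrA; congr (_ + _).
rewrite -big_split; apply: eq_bigr => a _.
by rewrite subSn 1?ltnW // big_ord_recr.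
Qed.

Lemma sum_triangle_exchange F m :
  \sum_(a < m) \sum_(k < m - a) F a k = \sum_(k < m) \sum_(a < m - k) F a k.
Proof.
rewrite -[RHS](sum_antidiagonals (fun k a => F a k)) -sum_antidiagonals.
apply: eq_bigr => b _; rewrite [RHS](reindex_inj rev_ord_inj); apply: eq_bigr => a _ /=.
by rewrite subSS subKn // -ltnS.
Qed.

(** Both sides run over the pairs whose sum is less than [m]. *)
Lemma sum_rev_triangle F m :
  \sum_(a < m.+1) \sum_(i < a) F i (m - a)%N = \sum_(b < m) \sum_(a < b.+1) F a (b - a)%N.
Proof.
rewrite sum_antidiagonals sum_triangle_exchange big_ord_recl big_ord0 add0r.
rewrite (reindex_inj rev_ord_inj); apply: eq_bigr => k _ /=.
by rewrite /bump add1n subnSK // subKn // ltnW.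
Qed.

Lemma sum_ord_rev (f : nat -> V) j : \sum_(i < j) f (j - i)%N = \sum_(i < j) f i.+1.
Proof.
rewrite (reindex_inj rev_ord_inj); apply: eq_bigr => i _ /=.
by rewrite subKn.
Qed.

End TriangularSums.

Lemma conv_rev_exp (p f : nat -> {poly rat}) m :
  \sum_(i < m.+1) 'X ^+ (i < m)%N * f i * p (m - i)%N =
  conv (fun i => 'X ^+ (0 < i)%N * p i) f m.
Proof.
rewrite /conv [RHS](reindex_inj rev_ord_inj); apply: eq_bigr => i _ /=.
by rewrite subSS subKn -1?ltnS // subn_gt0 mulrAC.
Qed.

Section WordSums.

(** [U a j] stands for the descent polynomial of the avoiding words with [a] letters -1 and [j]
    others, so [w m] collects those of length [m]. *)
Variables (p : nat -> {poly rat}) (U : nat -> nat -> {poly rat}).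
Hypothesis U0 : forall j, U 0%N j = p j.
Hypothesis Ua0 : forall a, U a 0%N = 1.
Hypothesis pS : forall m, p m.+1 = conv (fun i => 'X ^+ (0 < i)%N * p i) p m.

Let q i := 'X ^+ (0 < i)%N * p i.
Let w m := \sum_(a < m.+1) U a (m - a)%N.

Let p0 : p 0%N = 1. Proof. by rewrite -U0 Ua0. Qed.
Let w0 : w 0%N = 1. Proof. by rewrite /w big_ord1 Ua0. Qed.

Let conv_qw m : \sum_(a < m.+1) conv q (U a) (m - a)%N = conv q w m.
Proof.
transitivity (\sum_(a < m.+1) \sum_(i < m.+1 - a) q i * U a (m - i - a)%N).
  apply: eq_bigr => a _; rewrite subSn -1?ltnS //.
  by apply: eq_bigr => i _; rewrite subnAC.
rewrite (sum_triangle_exchange (fun a i => q i * U a (m - i - a)%N)).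
apply: eq_bigr => i _; rewrite mulr_sumr subSn // -ltnS //.
Qed.

Let w_recl m : w m = p m + \sum_(a < m) U a.+1 (m - a.+1)%N.
Proof. by rewrite /w big_ord_recl subn0 U0. Qed.

Let w_recr m : w m = \sum_(a < m) U a (m - a)%N + 1.
Proof. by rewrite /w big_ord_recr /= subnn Ua0. Qed.

(** Only words with at least one -1 can be cut at it; those without contribute [p m.+1]. *)
Lemma word_sum_min : (forall a j, U a.+1 j = conv q (U a) j) ->
  forall m, w m = conv p p m.
Proof.
move=> US; apply: eq_sqr_min => // m.
by rewrite w_recl -conv_qw; congr (_ + _); apply: eq_bigr => a _; rewrite US subSS.
Qed.

(** The isolated 1 is the word of letters -1 only, which has no greatest positive letter to cut
    at. *)
Let w_max m : w m.+1 = 1 + \sum_(a < m.+1) U a (m - a).+1.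
Proof.
rewrite w_recr addrC; congr (_ + _); apply: eq_bigr => a _.
by rewrite subSn // -ltnS.
Qed.

Lemma word_sum_231 :
  (forall a j, U a j.+1 = 'X * \sum_(i < a) U (a - i)%N j + conv q (U a) j) ->
  forall m, w m = conv p p m.
Proof.
move=> US; apply: eq_sqr_231 => // m.
rewrite w_max -addrA; congr (_ + _); rewrite addrC -conv_qw.
under eq_bigr do rewrite US.
rewrite big_split -mulr_sumr /=; congr (_ * _ + _).
under eq_bigr do rewrite (sum_ord_rev (fun a => U a _)).
(* The shifted index leaves out the words without -1, which is why [w b - p b] appears; its term at
   0 vanishes. *)
rewrite (sum_rev_triangle (fun i j => U i.+1 j)) [RHS]big_ord_recl w0 p0 subrr add0r.
apply: eq_bigr => b _; rewrite w_recl addrC addKr; apply: eq_bigr => a _.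
exact: congr1.
Qed.

Lemma word_sum_132 :
  (forall a j, U a j.+1 = U a j + 'X * \sum_(i < a) U i j
                          + 'X * \sum_(i < j) p i * U a (j - i)%N) ->
  forall m, w m = conv p p m.
Proof.
move=> US; apply: eq_sqr_132 => // m.
rewrite w_max -!addrA; congr (_ + _).
under eq_bigr do rewrite US.
rewrite 2!big_split -!mulr_sumr /= -addrA; congr (_ + (_ * _ + _ * _)).
  by rewrite sum_rev_triangle.
transitivity (\sum_(a < m) \sum_(i < m - a) p i * U a (m - i - a)%N).
  rewrite big_ord_recr /= subnn big_ord0 addr0; apply: eq_bigr => a _.
  by apply: eq_bigr => i _; rewrite subnAC.
rewrite (sum_triangle_exchange (fun a i => p i * U a (m - i - a)%N)).
(* The left part must leave at least one positive letter on the right, hence [w - 1] in place of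
   [w]. *)
rewrite /conv big_ord_recr /= subnn w0 subrr mulr0 addr0; apply: eq_bigr => i _.
by rewrite w_recr addrK mulr_sumr.
Qed.

End WordSums.

(** * The word sums of the four patterns as squares *)

(** [f] and [g] give the first letters of the two smaller blocks. The recursion involves them only
    as starting letters, so induction on the length removes the dependence. *)
Lemma shift_invariant (P : nat -> nat -> {poly rat}) (e : nat -> nat -> nat)
    (f g : nat -> nat -> nat -> nat) :
  (forall lo, P lo 0%N = 1) ->
  (forall lo j, P lo j.+1 =
     \sum_(i < j.+1) 'X ^+ e i j * P (f lo i j) i * P (g lo i j) (j - i)%N) ->
  forall lo lo' j, P lo j = P lo' j.
Proof.
move=> P0 PS lo lo' j; elim/ltn_ind: j lo lo' => -[|j] IH lo lo'; first by rewrite !P0.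
rewrite !PS; apply: eq_bigr => i _.
rewrite (IH i _ _ (f lo' i j)) // (IH (j - i)%N _ _ (g lo' i j)) //.
by rewrite ltnS leq_subr.
Qed.

Definition word_sum sigma m := \sum_(a < m.+1) word_poly sigma (-1) a 1 (m - a).

Lemma word_poly_a0 sigma x a lo : 2 \in sigma -> word_poly sigma x a lo 0 = 1.
Proof. by move=> s2; rewrite /word_poly cats0 des_poly_nseq. Qed.

Lemma word_sum_sqr_213 : exists2 p, is_narayana p &
  forall m, word_sum [:: 2; 1; 3]%N m = conv p p m.
Proof.
pose P := word_poly [:: 2; 1; 3]%N 0 0.
have P0 lo : P lo 0%N = 1 by rewrite /P word_poly_a0.
have PS lo j : P lo j.+1 = \sum_(i < j.+1) 'X ^+ (0 < i)%N
    * P (lo.+1 + j - i)%N i * P lo.+1 (j - i)%N.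
  (* The word block lo j.+1 is a single letter lo followed by block lo.+1 j. *)
  by apply: (@word_poly_213S lo%:Z 0 lo.+1); rewrite ltz_nat.
have PE lo j : P lo j = P 1%N j.
  exact: (@shift_invariant P (fun i _ => (0 < i)%N)
    (fun lo i j => (lo.+1 + j - i)%N) (fun lo _ _ => lo.+1)
    P0 PS).
have nar : is_narayana (P 1%N).
  by split=> // m; rewrite PS; apply: eq_bigr => i _; rewrite (PE (_ - _)%N) (PE 2).
exists (P 1%N) => //.
apply: (@word_sum_min _ (fun a => word_poly [:: 2; 1; 3]%N (-1) a 1)) => //;
  [by move=> a; rewrite word_poly_a0 | by case: nar |].
move=> a j; rewrite word_poly_213S //; apply: eq_bigr => i _.
(* With no copies of [x] its value is immaterial: the polynomials for -1 and for 0 are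
   convertible. *)
by rewrite -[word_poly _ _ 0 _ _]/(P _ _) PE.
Qed.

Lemma word_sum_sqr_312 : exists2 p, is_narayana p &
  forall m, word_sum [:: 3; 1; 2]%N m = conv p p m.
Proof.
pose P := word_poly [:: 3; 1; 2]%N 0 0.
have P0 lo : P lo 0%N = 1 by rewrite /P word_poly_a0.
have PS lo j : P lo j.+1 = \sum_(i < j.+1) 'X ^+ (0 < i)%N
    * P lo.+1 i * P (lo.+1 + i)%N (j - i)%N.
  by apply: (@word_poly_312S lo%:Z 0 lo.+1); rewrite ltz_nat.
have PE lo j : P lo j = P 1%N j.
  exact: (@shift_invariant P (fun i _ => (0 < i)%N)
    (fun lo _ _ => lo.+1) (fun lo i _ => (lo.+1 + i)%N)
    P0 PS).
have nar : is_narayana (P 1%N).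
  by split=> // m; rewrite PS; apply: eq_bigr => i _; rewrite (PE (_ + _)%N) (PE 2).
exists (P 1%N) => //.
(* The right part keeps its letters -1 but its block starts higher, so shift invariance is needed
   for every [a]. *)
have UE a lo j : word_poly [:: 3; 1; 2]%N (-1) a lo j = word_poly [:: 3; 1; 2]%N (-1) a 1 j.
  elim: a lo j => [|a IH] lo j; first exact: PE.
  rewrite !word_poly_312S //; apply: eq_bigr => i _.
  by rewrite !(IH (_ + _)%N) -![word_poly _ _ 0 _ _]/(P _ _) PE.
apply: (@word_sum_min _ (fun a => word_poly [:: 3; 1; 2]%N (-1) a 1)) => //;
  [by move=> a; rewrite word_poly_a0 | by case: nar |].
move=> a j; rewrite word_poly_312S //; apply: eq_bigr => i _.
by rewrite (UE _ (_ + _)%N).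
Qed.

Lemma word_sum_sqr_231 : exists2 p, is_narayana p &
  forall m, word_sum [:: 2; 3; 1]%N m = conv p p m.
Proof.
(* The letter -1 lies below every natural [lo], including 0, so the recurrence applies for all of
   them. *)
pose P := word_poly [:: 2; 3; 1]%N (-1) 0.
have P0 lo : P lo 0%N = 1 by rewrite /P word_poly_a0.
have PS lo j : P lo j.+1 = \sum_(i < j.+1) 'X ^+ (i < j)%N
    * P lo i * P (lo + i)%N (j - i)%N.
  by rewrite /P word_poly_231S // big_ord0 mulr0 add0r.
have PE lo j : P lo j = P 1%N j.
  exact: (@shift_invariant P (fun i j => (i < j)%N)
    (fun lo _ _ => lo) (fun lo i _ => (lo + i)%N)
    P0 PS).
have nar : is_narayana (P 1%N).
  split=> // m; rewrite PS -conv_rev_exp; apply: eq_bigr => i _.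
  by rewrite (PE (_ + _)%N).
exists (P 1%N) => //.
apply: (@word_sum_231 _ (fun a => word_poly [:: 2; 3; 1]%N (-1) a 1)) => //;
  [by move=> a; rewrite word_poly_a0 | by case: nar |].
move=> a j; rewrite word_poly_231S //; congr (_ + _); rewrite -conv_rev_exp.
by apply: eq_bigr => i _; rewrite -[word_poly _ _ 0 _ _]/(P _ _) PE.
Qed.

Lemma word_sum_sqr_132 : exists2 p, is_narayana p &
  forall m, word_sum [:: 1; 3; 2]%N m = conv p p m.
Proof.
pose P := word_poly [:: 1; 3; 2]%N (-1) 0.
have P0 lo : P lo 0%N = 1 by rewrite /P word_poly_a0.
have PS lo j : P lo j.+1 = \sum_(i < j.+1) 'X ^+ (i < j)%N
    * P (lo + j - i)%N i * P lo (j - i)%N.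
  rewrite /P word_poly_132S // big_ord0 mulr0 addr0 big_ord_recr /=.
  rewrite ltnn expr0 mul1r addnK subnn word_poly_a0 // mulr1 addrC; congr (_ + _).
  by rewrite mulr_sumr; apply: eq_bigr => i _; rewrite ltn_ord mulrA.
have PE lo j : P lo j = P 1%N j.
  exact: (@shift_invariant P (fun i j => (i < j)%N)
    (fun lo i j => (lo + j - i)%N) (fun lo _ _ => lo)
    P0 PS).
have nar : is_narayana (P 1%N).
  split=> // m; rewrite PS -conv_rev_exp; apply: eq_bigr => i _.
  by rewrite (PE (_ - _)%N).
exists (P 1%N) => //.
apply: (@word_sum_132 _ (fun a => word_poly [:: 1; 3; 2]%N (-1) a 1)) => //;
  [by move=> a; rewrite word_poly_a0 | by case: nar |].
move=> a j; rewrite word_poly_132S //; congr (_ + _ * _).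
by apply: eq_bigr => i _; rewrite -[word_poly _ _ 0 _ _]/(P _ _) PE.
Qed.

Lemma word_sum_sqr sigma :
  sigma \in [:: [:: 2; 1; 3]; [:: 3; 1; 2]; [:: 2; 3; 1]; [:: 1; 3; 2]]%N ->
  exists2 p, is_narayana p & forall m, word_sum sigma m = conv p p m.
Proof.
rewrite !inE => /or4P[] /eqP->.
- exact: word_sum_sqr_213.
- exact: word_sum_sqr_312.
- exact: word_sum_sqr_231.
- exact: word_sum_sqr_132.
Qed.

(** * Permutation forms of 2-arrangements *)

Definition positives (u : seq int) := [seq x <- u | 0 < x].

Lemma std_pos_uniq u : uniq (positives u) ->
  std_pos u =
  [seq (if 0 < x then Posz (count (fun y => y <= x) (positives u)) else x) | x <- u].
Proof.
move=> uu; apply: eq_map => x; case: ifP => // _; congr Posz.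
rewrite -[in RHS](undup_id uu) /positives -filter_undup count_filter.
by apply: eq_count => y /=; rewrite andbC.
Qed.

(** In the sorted list the entry at index [i] has rank [i + 1], and ranks are unaffected by
    reordering. *)
Lemma perm_ranks (v : seq int) : uniq v ->
  perm_eq [seq Posz (count (fun y => y <= x) v) | x <- v] (block 1 (size v)).
Proof.
move=> uv; set s := sort <=%R v.
have sv : perm_eq s v by rewrite perm_sort.
have ss : sorted <%R s by rewrite lt_sorted_uniq_le sort_uniq uv sort_le_sorted.
rewrite -(perm_size sv) /block map_comp; apply: perm_map.
apply: (@perm_trans _ [seq count (fun y => y <= x) s | x <- s]).
  rewrite (eq_map (g := fun x => count (fun y => y <= x) s)); last first.
    by move=> x; apply/esym; move: sv => /seq.permP; apply.
  by apply: perm_map; rewrite perm_sym.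
rewrite (_ : map _ _ = iota 1 (size s)) //; apply: (@eq_from_nth _ 0%N).
  by rewrite size_map size_iota.
move=> i; rewrite size_map => hi; rewrite (nth_map 0) // nth_iota //.
exact: (count_le_nth 0 ss hi).
Qed.

Lemma perm_std_pos u : uniq (positives u) ->
  perm_eq (std_pos u) ([seq x <- u | ~~ (0 < x)] ++ block 1 (size (positives u))).
Proof.
move=> uu; rewrite std_pos_uniq //; set f := fun x => _.
have := perm_map f (permEl (perm_filterC (fun x => 0 < x) u)).
rewrite perm_sym => /perm_trans; apply; rewrite map_cat perm_catC; apply: perm_cat.
  rewrite (_ : map f _ = [seq x <- u | ~~ (0 < x)]) // -[RHS]map_id.
  by apply/eq_in_map => x; rewrite mem_filter /f => /andP[/negPf-> _].
rewrite (_ : map f _ = [seq Posz (count (fun y => y <= x) (positives u)) | x <- positives u]).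
  exact: perm_ranks.
by apply/eq_in_map => x; rewrite mem_filter /f => /andP[-> _].
Qed.

Lemma pform_perm n (pi : 'S_n) (S : {set 'I_n}) :
  perm_eq (pform pi S) (nseq #|S| (-1) ++ block 1 (n - #|S|)).
Proof.
rewrite /pform; set f := fun i => _; set u := map f _.
have f_pos i : (0 < f i) = (i \notin S) by rewrite /f; case: (i \in S).
have posE : positives u = [seq f i | i <- enum [predC S]].
  rewrite /positives filter_map; congr map; rewrite -filter_predI; apply: eq_filter => i.
  by rewrite /= f_pos !inE andbT.
have sz : size (positives u) = (n - #|S|)%N.
  by rewrite posE size_map -cardE; have := cardC S; rewrite card_ord => /(canRL (addKn _)).
have uu : uniq (positives u).
  rewrite posE map_inj_in_uniq ?enum_uniq // => i j; rewrite !mem_enum !inE /f.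
  by move=> /negPf-> /negPf-> [/val_inj/perm_inj].
have := perm_std_pos uu; rewrite sz => /perm_trans; apply; rewrite perm_cat2r.
rewrite (_ : [seq x <- u | ~~ (0 < x)] = nseq #|S| (-1)) //.
rewrite filter_map.
have -> : [seq i <- enum 'I_n | preim f (fun x => ~~ (0 < x)) i] = enum S.
  by rewrite -filter_predI; apply: eq_filter => i; rewrite /= f_pos negbK andbT.
rewrite cardE -(size_map f); apply/all_pred1P; apply/allP => y /mapP[i].
by rewrite mem_enum /f => -> -> /=.
Qed.

Lemma pform_surj n a w : (a <= n)%N -> perm_eq w (nseq a (-1) ++ block 1 (n - a)) ->
  exists (pi : 'S_n) (S : {set 'I_n}), S \subset FIX pi /\ w = pform pi S.
Proof.
move=> an wp.
have sw : size w = n by rewrite (perm_size wp) size_cat size_nseq size_block subnKC.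
pose x (i : 'I_n) := nth 0 w i.
have wE : w = [seq x i | i <- enum 'I_n].
  by rewrite /x (map_comp (nth 0 w) val) val_enum_ord -/(mkseq _ _) -[in LHS](mkseq_nth 0 w) sw.
have xw i : x i \in w by rewrite mem_nth // sw.
have x_le0 i : ~~ (0 < x i) -> x i = -1.
  by have := xw i; rewrite (perm_mem wp) mem_cat mem_nseq mem_block; lia.
pose C := enum [pred i : 'I_n | 0 < x i].
have posE : positives w = map x C.
  rewrite /positives wE filter_map; congr map; rewrite -filter_predI.
  by apply: eq_filter => i; rewrite /= andbT.
have pos_block : perm_eq (positives w) (block 1 (n - a)).
  apply: perm_trans (perm_filter _ wp) _; rewrite filter_cat.
  rewrite (@eq_in_filter _ _ pred0 (nseq a _)) => [|y]; last first.
    by rewrite mem_nseq => /andP[_ /eqP->].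
  rewrite (@eq_in_filter _ _ predT (block _ _)) => [|y]; last by rewrite mem_block /=; lia.
  by rewrite filter_pred0 filter_predT.
have szC : size C = (n - a)%N by rewrite -(size_map x) -posE (perm_size pos_block) size_block.
have xC i : 0 < x i -> (`|x i|.-1 < size C)%N.
  move=> xi; rewrite szC; have : x i \in positives w by rewrite mem_filter xi xw.
  by rewrite (perm_mem pos_block) mem_block; lia.
have x_inj : {in [pred i | 0 < x i] &, injective x}.
  apply/dinjectiveP; rewrite /dinjectiveb -posE (perm_uniq pos_block).
  rewrite map_inj_uniq ?iota_uniq //.
  by move=> ? ? [].
(* The -1s are fixed points, and the other letters permute the remaining
   positions, listed increasingly by C, as they permute 1 .. n - a. *)
pose f i := if 0 < x i then nth i C `|x i|.-1 else i.
have fC i : (f i \in C) = (i \in C).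
  rewrite /f !mem_enum !inE; case: ifP => [xi|->//].
  by have := mem_nth i (xC _ xi); rewrite mem_enum inE.
have f_inj : injective f.
  move=> i k fik; have := fC i; rewrite fik fC !mem_enum !inE => xik.
  move: fik; rewrite /f xik; case: ifP => // xi.
  have xk : 0 < x k by rewrite xik.
  rewrite (set_nth_default i k) ?xC // => /eqP.
  rewrite nth_uniq ?xC ?enum_uniq // => /eqP xE; apply: x_inj => //; lia.
pose pi := perm f_inj; pose S := [set i | ~~ (0 < x i)].
exists pi, S; split.
  by apply/subsetP => i; rewrite !inE permE /f => /negPf->.
rewrite /pform; set u := map _ _.
have u_pos i : 0 < (if i \in S then -1 else (pi i).+1%:Z) = (0 < x i).
  by rewrite inE; case: (0 < x i).
have uposE : positives u = [seq (f i).+1%:Z | i <- C].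
  rewrite /positives filter_map (eq_filter (a2 := [pred i | 0 < x i])) => [|i]; last first.
    exact: u_pos.
  rewrite (_ : filter _ _ = C); last first.
    by rewrite -filter_predI; apply: eq_filter => i /=; rewrite andbT.
  by apply/eq_in_map => i; rewrite mem_enum inE permE => xi; rewrite inE xi.
pose D := [seq i.+1%:Z | i : 'I_n <- C].
(* An injective map of the finite set [C] into itself permutes it. *)
have fCC : perm_eq (map f C) C.
  have fCu : uniq (map f C) by rewrite map_inj_uniq ?enum_uniq.
  have fCs : {subset map f C <= C} by move=> _ /mapP[i iC ->]; rewrite fC.
  have [_ fCE] := uniq_min_size fCu fCs (eq_leq (esym (size_map f C))).
  by apply: uniq_perm; rewrite ?enum_uniq.
have uD : perm_eq (positives u) D.
  by rewrite uposE (map_comp (fun i : 'I_n => i.+1%:Z) f) perm_map.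
have D_sorted : sorted <%R D.
  rewrite sorted_map; apply: (@sub_sorted _ (relpre val ltn)) => [i k|].
    by rewrite /= ltz_nat.
  rewrite -sorted_map; apply: (subseq_sorted ltn_trans) (iota_ltn_sorted 0 n).
  rewrite -val_enum_ord; apply: map_subseq; rewrite /C enumT; apply: filter_subseq.
rewrite std_pos_uniq; last first.
  by rewrite (perm_uniq uD) lt_sorted_uniq.
rewrite /u -map_comp [LHS]wE; apply: eq_map => i /=.
rewrite u_pos; case: ifP => xi; last by rewrite inE xi x_le0 ?xi.
move/seq.permP: uD => ->; rewrite inE xi permE /f xi.
(* The letter placed at [i] is the entry of [D] at index [x i - 1], so its rank, and hence its
   standardized value, is [x i]. *)
have := count_le_nth 0 D_sorted.
move=> /(_ `|x i|.-1); rewrite size_map => /(_ (xC _ xi)).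
rewrite (nth_map i) ?xC // => ->; lia.
Qed.

Lemma mem_P2 n w :
  reflect (exists2 a, (a <= n)%N & perm_eq w (nseq a (-1) ++ block 1 (n - a))) (w \in P2 n).
Proof.
rewrite mem_undup; apply: (iffP flatten_mapP) => [[pi _ /mapP[S _ ->]]|[a an wp]].
  by exists #|S|; rewrite ?pform_perm // -[leqRHS]card_ord max_card.
have [pi [S [Spi ->]]] := pform_surj an wp.
exists pi; first by rewrite mem_enum.
by apply: map_f; rewrite mem_filter Spi mem_enum.
Qed.

(** * From descent polynomials to the count *)

Lemma sum_P2av sigma m :
  \sum_(w <- P2av m sigma) 'X ^+ des w = word_sum sigma m.
Proof.
rewrite big_filter.
pose W := [seq w | a <- iota 0 m.+1, w <- permutations (nseq a (-1) ++ block 1 (m - a))].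
have permW : perm_eq (P2 m) W.
  apply: uniq_perm; first exact: undup_uniq.
    apply: allpairs_uniq_dep; [exact: iota_uniq|by move=> a _; apply: permutations_uniq|].
    move=> [a w] [b w'] /allpairsPdep[a1 [w1 [_ ha E]]] /allpairsPdep[b1 [w2 [_ hb E']]].
    case: E E' => -> -> [-> ->] /= ww.
    (* The number of letters -1 recovers [a], so the lists for different [a] are disjoint. *)
    have cnt c v : v \in permutations (nseq c (-1) ++ block 1 (m - c)) -> count_mem (-1) v = c.
      rewrite mem_permutations => /seq.permP->; rewrite count_cat count_nseq /= mul1n.
      by rewrite (count_memPn _) ?addn0 // mem_block.
    by rewrite ww -(cnt _ _ ha) -(cnt _ _ hb) ww.
  move=> w; apply/mem_P2/allpairsPdep => [[a am wp]|[a [v [am wp ->]]]]; exists a.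
  - exists w; split=> //; [by rewrite mem_iota | by rewrite mem_permutations].
  - by move: am; rewrite mem_iota.
  - by rewrite mem_permutations in wp.
rewrite (perm_big _ permW) big_mkcond big_allpairs_dep /word_sum.
rewrite -[iota _ _]/(index_iota 0 _.+1) big_mkord; apply: eq_bigr => a _.
by rewrite -big_mkcond.
Qed.

Theorem theorem4p2 (sigma : seq nat)
  (hsigma : sigma \in [:: [:: 2; 1; 3]; [:: 3; 1; 2]; [:: 2; 3; 1]; [:: 1; 3; 2]]%N)
  (n k : nat) (hn : (2 <= n)%N) (hk : (k <= n - 2)%N) :
  (count (fun w => des w == k) (P2av n.-1 sigma))%:R
    = (2%:R / (n.+1)%:R) * ('C(n.+1, k.+2))%:R * ('C(n - 2, k))%:R :> rat.
Proof.
case: n hn hk => [|[|m]] // _; rewrite subn2 /= => hk.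
have [p [p0 pS] wE] := word_sum_sqr hsigma.
(* With $n=m+2$ the words have length $m+1$, and the count is the coefficient of $t^k$ in their
   descent polynomial. *)
rewrite -(coef_narayana_sqr p0 pS hk) -wE -sum_P2av coef_sum.
rewrite -sum1_count natr_sum big_mkcond; apply: eq_bigr => w _.
by rewrite coefXn eq_sym; case: eqP.
Qed.
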